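(* Let $M\in\mathbb N$ with $M\ge 1$, and let $\Theta_j=\{P_j,q_j,r_j\}$ for $j\in\{0,1,\dots,M\}$, where $P_j\in\mathbb S^2_{++}$, $q_j\in\mathbb R^2$, $r_j\in\mathbb R$, with associated quadratic functions $\hat V_j(\xi)=\xi^\top P_j\xi+2q_j^\top\xi+r_j$. Fix $u\in\mathbb U$ and $j\in\{1,\dots,M\}$, and suppose there exists $\tau\ge 0$ such that $$G(\Theta_j,\Theta_{j-1})\succeq \tau F(u),$$ where $G(\Theta_j,\Theta_{j-1})$ and $F(u)$ are the symmetric $5\times 5$ matrices $$G(\Theta_j,\Theta_{j-1})=\begin{bmatrix}Q_y & q_y\\ q_y^\top & r_y\end{bmatrix},\qquad F(u)=\begin{bmatrix}0&0&0\\0&-S&0\\0&0&\|u\|_2^2\end{bmatrix}$$ (blocks of $F(u)$ of sizes $2,2,1$), with $C=[A_d\ \ I]\in\mathbb R^{2\times 4}$, $S=(B_d^\top B_d)^{-1}$ and $$Q_y=\gamma C^\top P_jC+\begin{bmatrix}I-P_{j-1}&0\\0&0\end{bmatrix},\qquad q_y=\gamma\left(\bar x_e^\top P_jC+q_j^\top C\right)^\top-\begin{bmatrix}q_{j-1}\\0\end{bmatrix},$$ $$r_y=\gamma\left(\bar x_e^\top P_j\bar x_e+2q_j^\top\bar x_e+r_j\right)-r_{j-1}.$$ Then, for the given $u$ and $j$, $$\hat V_{j-1}(\xi)\le \ell(\xi)+\gamma\,\hat V_j\big(f(\xi,\theta_{\mathrm{re}},u)\big)\qquad\text{for all }\xi\in\mathbb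 R^2\text{ and all }\theta_{\mathrm{re}}\in[0,2\pi).$$
   Context: Setting (discretized error dynamics of a three-phase permanent-magnet synchronous motor). Real constants: $L_d,L_q>0$ (inductances), $R$ (stator resistance), $\Lambda_{PM}$ (flux linkage), $\omega_{\mathrm{re}}$ (electrical speed), $T_s>0$ (sampling time), $V_{bus}>0$ (bus voltage), an integer $N_{level}\ge 2$, a discount factor $\gamma\in(0,1)$, and a desired current $i_{dq}^{r\star}\in\mathbb R^2$. Define $$A=\begin{bmatrix}-R/L_d & \omega_{\mathrm{re}}L_q/L_d\\ -\omega_{\mathrm{re}}L_d/L_q & -R/L_q\end{bmatrix},\quad B=\begin{bmatrix}L_d^{-1}&0\\0&L_q^{-1}\end{bmatrix},\quad E=\begin{bmatrix}0\\ \Lambda_{PM}\end{bmatrix},$$ $A_d=T_sA+I$, $B_d=T_sB$, $E_d=T_sE$, $\bar x_e=(A_d-I)i_{dq}^{r\star}+E_d$. Rotation matrix: $\mathsf R(\theta)=\begin{bmatrix}\cos\theta&\sin\theta\\-\sin\theta&\cos\theta\end{bmatrix}$. Finite control set: $\mathbb U=\{\tfrac{V_{bus}}{N_{level}-1}T_C s:\ s\in\{0,1,\dots,N_{level}-1\}^3\}\subset\mathbb R^2$ with $T_C=\frac13\begin{bmatrix}2&-1&-1\\0&\sqrt3&-\sqrt3\end{bmatrix}$. Error dynamics map: $f(\xi,\theta_{\mathrm{re}},u)=A_d\xi+B_d\mathsf R(\theta_{\mathrm{re}})u+\bar x_e$. Stage cost: $\ell(\xi)=\|\xi\|_2^2$.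 $\mathbb S^2_{++}$ is the set of $2\times2$ real symmetric positive definite matrices; $X\succeq Y$ means $X-Y$ is positive semidefinite. *)

(* Defs.v *)
From HB Require Import structures.
From mathcomp Require Import all_boot all_order all_algebra.
From mathcomp Require Import classical_sets reals trigo.

Set Implicit Arguments.
Unset Strict Implicit.
Unset Printing Implicit Defensive.
Import Order.TTheory GRing.Theory Num.Theory.
Local Open Scope ring_scope.

Section LinearAlgebra.
Variable K : realType.

Definition mx_of_rows (m n : nat) (rows : seq (seq K)) : 'M[K]_(m, n) :=
  \matrix_(i < m, j < n) nth 0 (nth [::] rows i) j.

(* Euclidean norm; the library norm on matrices is the sup norm. *)
Definition norm2 (n : nat) (x : 'cV[K]_n) : K :=
  Num.sqrt (\sum_(i < n) x i 0 ^+ 2).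

Definition posdefmx (n : nat) (X : 'M[K]_n) : Prop :=
  X \is symmetricmx /\
  (forall x : 'cV[K]_n, x != 0 -> 0 < (x^T *m X *m x) 0 0).

Definition possemidefmx (n : nat) (X : 'M[K]_n) : Prop :=
  X \is symmetricmx /\ (forall x : 'cV[K]_n, 0 <= (x^T *m X *m x) 0 0).

Definition loewner_ge (n : nat) (X Y : 'M[K]_n) : Prop := possemidefmx (X - Y).

End LinearAlgebra.

Record motor (K : realType) := Motor {
  Ld : K;              (* d-axis inductance *)
  Lq : K;              (* q-axis inductance *)
  Rs : K;              (* stator resistance *)
  Lambda_PM : K;       (* flux linkage *)
  omega_re : K;        (* electrical speed *)
  Ts : K;              (* sampling time *)
  Vbus : K;            (* bus voltage *)
  Nlevel : nat;
  gamma : K;           (* discount factor *)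
  i_ref : 'cV[K]_2     (* desired current in dq coordinates *)
}.

(* Parameters (P, q, r) of the quadratic function x^T P x + 2 q^T x + r. *)
Record quad (K : realType) := Quad {
  quadP : 'M[K]_2;
  quadq : 'cV[K]_2;
  quadr : K
}.

Section ErrorDynamics.
Variables (K : realType) (m : motor K).

Definition Amx : 'M[K]_2 := mx_of_rows 2 2
  [:: [:: - Rs m / Ld m;                 omega_re m * Lq m / Ld m];
      [:: - omega_re m * Ld m / Lq m;    - Rs m / Lq m]].

Definition Bmx : 'M[K]_2 := mx_of_rows 2 2
  [:: [:: (Ld m)^-1; 0];
      [:: 0;         (Lq m)^-1]].

Definition Evec : 'cV[K]_2 := mx_of_rows 2 1 [:: [:: 0]; [:: Lambda_PM m]].

Definition Ad : 'M[K]_2 := Ts m *: Amx + 1%:M.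
Definition Bd : 'M[K]_2 := Ts m *: Bmx.
Definition Ed : 'cV[K]_2 := Ts m *: Evec.
Definition xbar_e : 'cV[K]_2 := (Ad - 1%:M) *m i_ref m + Ed.

Definition rotmx (theta : K) : 'M[K]_2 := mx_of_rows 2 2
  [:: [:: cos theta;   sin theta];
      [:: - sin theta; cos theta]].

Definition T_C : 'M[K]_(2, 3) := 3^-1 *: mx_of_rows 2 3
  [:: [:: 2; -1;         -1];
      [:: 0; Num.sqrt 3; - Num.sqrt 3]].

Definition control_set : set 'cV[K]_2 :=
  [set (Vbus m / ((Nlevel m)%:R - 1)) *: (T_C *m \col_(k < 3) (s k)%:R)
     | s in [set: {ffun 'I_3 -> 'I_(Nlevel m)}]]%classic.

Definition err_dyn (xi : 'cV[K]_2) (theta : K) (u : 'cV[K]_2) : 'cV[K]_2 :=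
  Ad *m xi + Bd *m rotmx theta *m u + xbar_e.

Definition stage_cost (xi : 'cV[K]_2) : K := norm2 xi ^+ 2.

Definition Vhat (T : quad K) (xi : 'cV[K]_2) : K :=
  (xi^T *m quadP T *m xi) 0 0 + 2 * ((quadq T)^T *m xi) 0 0 + quadr T.

Definition Cmx : 'M[K]_(2, 2 + 2) := row_mx Ad 1%:M.
Definition Smx : 'M[K]_2 := invmx (Bd^T *m Bd).

Definition Q_y (T T' : quad K) : 'M[K]_(2 + 2) :=
  gamma m *: (Cmx^T *m quadP T *m Cmx) + block_mx (1%:M - quadP T') 0 0 0.

Definition q_y (T T' : quad K) : 'cV[K]_(2 + 2) :=
  gamma m *: (xbar_e^T *m quadP T *m Cmx + (quadq T)^T *m Cmx)^T
  - col_mx (quadq T') 0.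

Definition r_y (T T' : quad K) : K :=
  gamma m * ((xbar_e^T *m quadP T *m xbar_e) 0 0
             + 2 * ((quadq T)^T *m xbar_e) 0 0 + quadr T)
  - quadr T'.

Definition Gmx (T T' : quad K) : 'M[K]_(2 + 2 + 1) :=
  block_mx (Q_y T T') (q_y T T') (q_y T T')^T (r_y T T')%:M.

Definition Fmx (u : 'cV[K]_2) : 'M[K]_(2 + 2 + 1) :=
  block_mx (block_mx 0 0 0 (- Smx)) 0 0 (norm2 u ^+ 2)%:M.

End ErrorDynamics.

Arguments T_C {K}.

(* Main.v *)
(* Take y = (xi, w, 1) with w = B_d R(theta) u.  Then y^T G y is the gap
   l(xi) + gamma V_j(f(xi, theta, u)) - V_(j-1)(xi).  Since R(theta) is orthogonal, w lies
   on the ellipsoid w^T S w = |u|^2 for every theta, i.e. y^T F(u) y = 0, so the matrix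
   inequality (S-procedure) makes the gap nonnegative. *)
Require Import Defs.
From mathcomp Require Import all_boot all_order all_algebra.
From mathcomp Require Import classical_sets reals trigo.
From mathcomp Require Import ring.
Import Order.TTheory GRing.Theory Num.Theory.
Local Open Scope ring_scope.

Lemma quadform_block (K : comNzRingType) (m n : nat) (a : 'cV[K]_m) (b : 'cV[K]_n)
    (A : 'M_m) (B : 'M_(m, n)) (C : 'M_(n, m)) (D : 'M_n) :
  (col_mx a b)^T *m block_mx A B C D *m col_mx a b =
  a^T *m A *m a + b^T *m C *m a + (a^T *m B *m b + b^T *m D *m b).
Proof. by rewrite tr_col_mx mul_row_block mul_row_col !mulmxDl. Qed.

(** A 1 by 1 matrix equals its transpose; reading its entry as a trace gives access to
    [mxtrace_tr]. *)
Lemma bilinC (K : comNzRingType) (m n : nat) (X : 'M[K]_(m, n))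
    (x : 'cV[K]_m) (y : 'cV[K]_n) :
  (x^T *m X *m y) 0 0 = (y^T *m X^T *m x) 0 0.
Proof. by rewrite -!trace_mx11 -[LHS]mxtrace_tr !trmx_mul trmxK mulmxA. Qed.

Lemma norm2_sqr (K : realType) (n : nat) (x : 'cV[K]_n) :
  norm2 x ^+ 2 = (x^T *m x) 0 0.
Proof.
rewrite /norm2 sqr_sqrtr; last by apply: sumr_ge0 => i _; apply: sqr_ge0.
by rewrite mxE; apply: eq_bigr => i _; rewrite !mxE expr2.
Qed.

Lemma rotmx_orthogonal (K : realType) (theta : K) :
  (rotmx theta)^T *m rotmx theta = 1%:M.
Proof.
apply/matrixP => i k; rewrite !mxE !big_ord_recl big_ord0 !mxE.
have := cos2Dsin2 theta.
(* Replacing [1] by cos^2 + sin^2, and not the converse, leaves polynomial identities for [ring]. *)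
case: i => [[|[|//]] ?]; case: k => [[|[|//]] ?] /= <-; rewrite ?mulr1n ?mulr0n; ring.
Qed.

Lemma Bd_unit (K : realType) (m : motor K) :
  0 < Ld m -> 0 < Lq m -> 0 < Ts m -> Bd m \in unitmx.
Proof.
move=> /gt_eqF/negbT Ld0 /gt_eqF/negbT Lq0 /gt_eqF/negbT Ts0.
pose B' : 'M_2 := (Ts m)^-1 *: mx_of_rows 2 2 [:: [:: Ld m; 0]; [:: 0; Lq m]].
suff /mulmx1_unit[] : Bd m *m B' = 1%:M by [].
apply/matrixP => i k; rewrite !mxE !big_ord_recl big_ord0 !mxE.
by case: i => [[|[|//]] ?]; case: k => [[|[|//]] ?] /=; rewrite ?mulr1n ?mulr0n;
  field; rewrite ?Ld0 ?Lq0 ?Ts0.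
Qed.

Lemma Bd_sym (K : realType) (m : motor K) : (Bd m)^T = Bd m.
Proof.
by apply/matrixP; case=> [[|[|//]] ?]; case=> [[|[|//]] ?]; rewrite !mxE.
Qed.

(* [Smx] is the inverse of B_d^T B_d, whereas the ellipsoid calls for that of B_d B_d^T:
   they agree because B_d is diagonal. *)
Lemma rotated_input_ellipsoid (K : realType) (m : motor K) (u : 'cV[K]_2) (theta : K) :
  Bd m \in unitmx ->
  let w := Bd m *m rotmx theta *m u in (w^T *m Smx m *m w) 0 0 = norm2 u ^+ 2.
Proof.
move=> uB w; rewrite norm2_sqr /w /Smx !trmx_mul Bd_sym.
have uBB : Bd m *m Bd m \in unitmx by rewrite unitmx_mul uB.
have -> : invmx (Bd m *m Bd m) = invmx (Bd m) *m invmx (Bd m).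
  by apply: (can_inj (mulKmx uBB)); rewrite mulmxV // mulmxA (mulmxK uB) mulmxV.
(* Each [invmx (Bd m)] cancels an adjacent [Bd m], leaving u^T R^T R u. *)
rewrite !mulmxA (mulmxK uB) (mulmxKV uB).
by rewrite -(mulmxA _ _ (rotmx _)) rotmx_orthogonal mulmx1.
Qed.

(** The last coordinate 1 turns the corner entry into the constant |u|^2, so the form vanishes
    exactly when w lies on the ellipsoid. *)
Lemma quadform_Fmx (K : realType) (m : motor K) (u xi w : 'cV[K]_2) :
  let y := col_mx (col_mx xi w) 1%:M in
  (y^T *m Fmx m u *m y) 0 0 = norm2 u ^+ 2 - (w^T *m Smx m *m w) 0 0.
Proof.
rewrite /Fmx !quadform_block !mulmx0 !mul0mx !add0r addr0.
rewrite trmx1 mul1mx mulmx1 mulmxN mulNmx [LHS]mxE addrC !mxE mulr1n; ring.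
Qed.

(** With z = (xi, w), the successor state is C z + xbar_e, affine in z. The quadratic, linear and
    constant parts of the gap in z are [Q_y], 2 [q_y] and [r_y]; this holds for every w. *)
Lemma quadform_Gmx (K : realType) (m : motor K) (T T' : quad K) (xi w : 'cV[K]_2) :
  quadP T \is symmetricmx ->
  let y := col_mx (col_mx xi w) 1%:M in
  (y^T *m Gmx m T T' *m y) 0 0 =
  stage_cost xi + gamma m * Vhat T (Ad m *m xi + w + xbar_e m) - Vhat T' xi.
Proof.
rewrite is_hermitianmxE expr0 scale1r => /eqP symP y.
(* [symmetricmx] involves an entrywise map by the identity, removed here. *)
have {}symP : quadP T = (quadP T)^T
  by rewrite [LHS]symP; apply/matrixP => i k; rewrite !mxE.
have Cz : Cmx m *m col_mx xi w = Ad m *m xi + w by rewrite mul_row_col mul1mx.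
rewrite /y /Gmx quadform_block /Vhat /stage_cost norm2_sqr -Cz.
set z := col_mx xi w; set x := xbar_e m; set P := quadP T in symP *; set C := Cmx m.
have zQz : (z^T *m Q_y m T T' *m z) 0 0 = gamma m * ((C *m z)^T *m P *m (C *m z)) 0 0
    + (xi^T *m xi) 0 0 - (xi^T *m quadP T' *m xi) 0 0.
  rewrite /Q_y mulmxDr mulmxDl quadform_block !mulmx0 !mul0mx !addr0 -scalemxAr -scalemxAl.
  rewrite mulmxBr mulmxBl mulmx1 trmx_mul !mulmxA.
  by rewrite -!trace_mx11 !mxtraceD mxtraceZ raddfN addrA.
have qz : ((q_y m T T')^T *m z) 0 0 = gamma m * ((x^T *m P *m (C *m z)) 0 0
    + ((quadq T)^T *m (C *m z)) 0 0) - ((quadq T')^T *m xi) 0 0.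
  rewrite /q_y linearB linearZ /= trmxK tr_col_mx mulmxBl -scalemxAl mulmxDl mul_row_col.
  rewrite trmx0 mul0mx addr0 !mulmxA.
  by rewrite -!trace_mx11 mxtraceD mxtraceZ mxtraceD raddfN.
have zq : (z^T *m q_y m T T') 0 0 = ((q_y m T T')^T *m z) 0 0.
  by rewrite -!trace_mx11 -[LHS]mxtrace_tr trmx_mul trmxK.
(* Symmetry of P merges the two cross terms of (C z + x)^T P (C z + x), matching the two
   off-diagonal blocks of G. *)
have cross : ((C *m z)^T *m P *m x) 0 0 = (x^T *m P *m (C *m z)) 0 0.
  by rewrite bilinC -symP.
rewrite -/P /r_y -/x -/P; move: (Q_y m T T') (q_y m T T') zQz qz zq => Q q zQz qz zq.
clearbody x C P z.
rewrite trmx1 !mul1mx !mulmx1 [(_ + x)^T]linearD !mulmxDl !mulmxDr.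
rewrite -!trace_mx11 !mxtraceD mxtrace_scalar mulr1n !trace_mx11.
rewrite zq zQz qz cross; ring.
Qed.

Theorem proposition1 (K : realType) (m : motor K)
  (Ld_gt0 : 0 < Ld m) (Lq_gt0 : 0 < Lq m) (Ts_gt0 : 0 < Ts m)
  (Vbus_gt0 : 0 < Vbus m) (Nlevel_ge2 : (2 <= Nlevel m)%N)
  (gamma_gt0 : 0 < gamma m) (gamma_lt1 : gamma m < 1)
  (M : nat) (M_ge1 : (1 <= M)%N)
  (Theta : 'I_M.+1 -> quad K)
  (P_posdef : forall k : 'I_M.+1, posdefmx (quadP (Theta k)))
  (u : 'cV[K]_2) (u_in_U : control_set m u)
  (j j' : 'I_M.+1) (j_ge1 : (1 <= j)%N) (j'_eq : j' = (j - 1)%N :> nat)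
  (Htau : exists tau : K, 0 <= tau /\
    loewner_ge (Gmx m (Theta j) (Theta j')) (tau *: Fmx m u)) :
  forall (xi : 'cV[K]_2) (theta_re : K), 0 <= theta_re < 2 * pi ->
    Vhat (Theta j') xi
    <= stage_cost xi + gamma m * Vhat (Theta j) (err_dyn m xi theta_re u).
Proof.
move: Htau => [tau [_ [_ psd]]] xi theta _.
have [symP _] := P_posdef j.
have := psd (col_mx (col_mx xi (Bd m *m rotmx theta *m u)) 1%:M).
have := quadform_Gmx _ m _ (Theta j') xi (Bd m *m rotmx theta *m u) symP.
have := quadform_Fmx _ m u xi (Bd m *m rotmx theta *m u).
(* The form of F(u) is now |u|^2 - |u|^2 = 0, and unfolding [err_dyn] exposes the successor state of
   [quadform_Gmx]. *)
rewrite /= rotated_input_ellipsoid ?Bd_unit // subrr /err_dyn.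
move: (col_mx _ 1%:M) (Gmx _ _ _) (Fmx m u) => y G F yFy yGy.
rewrite mulmxBr mulmxBl -scalemxAr -scalemxAl -trace_mx11.
by rewrite mxtraceD raddfN /= mxtraceZ !trace_mx11 yFy yGy mulr0 subr0 subr_ge0.
Qed.
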